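(* Let $d\le N$ be positive integers and let $X, X'\in \mathbb{Z}^{d\times N}$ be matrices of rank $d$ that represent the same arithmetic matroid $\mathcal{A}=(E,\operatorname{rk},m)$ on $E=[N]$, and suppose that $\mathcal{A}$ is weakly multiplicative. Then there exist a matrix $T\in \mathrm{GL}(d,\mathbb{Z})$ and a diagonal matrix $D\in\mathbb{Z}^{N\times N}$ with diagonal entries in $\{1,-1\}$ such that $X' = T X D$.
   Context: For $X\in\mathbb{Z}^{d\times N}$ with columns $x_1,\dots,x_N$, the arithmetic matroid $\mathcal{A}(X)=([N],\operatorname{rk},m)$ represented by $X$ consists of the rank function $\operatorname{rk}(S)=\dim \langle x_e : e\in S\rangle_{\mathbb{R}}$ and the multiplicity function $m(S)=\bigl|(\langle S\rangle_{\mathbb{R}}\cap\mathbb{Z}^d)/\langle S\rangle\bigr|$ for $S\subseteq[N]$, where $\langle S\rangle\subseteq\mathbb{Z}^d$ is the subgroup generated by $\{x_e: e\in S\}$ and $\langle S\rangle_{\mathbb{R}}$ is the real span of the same vectors. Two matrices represent the same arithmetic matroid if their rank functions and multiplicity functions on subsets of $[N]$ coincide. A basis of $\mathcal{A}$ is a basis of the underlying matroid $([N],\operatorname{rk})$. The arithmetic matroid is torsion-free if $m(\emptyset)=1$ (automatic here). A basis $B$ is multiplicative if $m(B)=\prod_{x\in B} m(\{x\})$; a torsion-free arithmetic matroid is weakly multiplicative if it has at least one multiplicative basis. *)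

(* Defs.v *)
From HB Require Import structures.
From mathcomp Require Import all_boot all_order all_algebra.
From mathcomp Require Import Rstruct.
From Stdlib Require Import Rdefinitions.
Set Implicit Arguments. Unset Strict Implicit. Unset Printing Implicit Defensive.
Import Order.TTheory GRing.Theory Num.Theory.
Local Open Scope ring_scope.

Notation RR := Rdefinitions.R.

Definition intR (z : int) : RR := z%:~R.

Section ArithMatroid.
Variables (d N : nat).
Implicit Types (X : 'M[int]_(d, N)) (S : {set 'I_N}).

(* The matrix whose rows are the real vectors x_e (e in S), and 0 for e not in S:
   its row space is the real span <S>_R of {x_e : e in S}. *)
Definition colsR X S : 'M[RR]_(N, d) :=
  \matrix_(i < N, j < d) if i \in S then intR (X j i) else 0.

Definition arank X S : nat := \rank (colsR X S).

Definition in_lattice X S (v : 'cV[int]_d) : Prop :=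
  exists c : 'I_N -> int, v = \sum_(e in S) c e *: col e X.

Definition in_saturation X S (v : 'cV[int]_d) : Prop :=
  (map_mx intR v^T <= colsR X S)%MS.

(* mult X S k  <->  |(<S>_R ∩ Z^d) / <S>| = k :
   there is a complete, irredundant system of k coset representatives. *)
Definition mult X S (k : nat) : Prop :=
  exists reps : 'I_k -> 'cV[int]_d,
    [/\ forall i, in_saturation X S (reps i),
        forall i j, in_lattice X S (reps i - reps j) -> i = j
      & forall v, in_saturation X S v -> exists i, in_lattice X S (v - reps i)].

Definition same_arith_matroid X X' : Prop :=
  forall S, arank X S = arank X' S /\ (forall k, mult X S k <-> mult X' S k).

Definition is_basis X S : Prop :=
  arank X S = #|S| /\ arank X S = arank X [set: 'I_N].

Definition multiplicative_basis X S : Prop :=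
  exists (mB : nat) (mx : 'I_N -> nat),
    [/\ mult X S mB, forall x, x \in S -> mult X [set x] (mx x)
      & mB = (\prod_(x in S) mx x)%N].

Definition weakly_multiplicative X : Prop :=
  exists B, is_basis X B /\ multiplicative_basis X B.

End ArithMatroid.

(* Main.v *)
Require Import Defs.
From HB Require Import structures.
From mathcomp Require Import all_boot all_order all_algebra.
From mathcomp Require Import Rstruct zify ring.
Set Implicit Arguments. Unset Strict Implicit. Unset Printing Implicit Defensive.
Import Order.TTheory GRing.Theory Num.Theory.
Local Open Scope ring_scope.

(** The multiplicity of a basis is the absolute value of its determinant, and
    that of a nonzero vector is its content.  A multiplicative basis [B]
    therefore satisfies [X_B = P diag(k)] and [X'_B = P' diag(k)] with [P], [P']
    unimodular and the same contents [k], so one may assume that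
    [X_B = X'_B = diag(k)].  All maximal minors of [X] and [X'] agree up to sign,
    and [X' = D1 X D2] with sign matrices [D1], [D2] follows by adding one column
    at a time: if the new column [a] of [X] and [a'] of [X'] cannot be matched by
    flipping signs on connected components of the support graph of the previous
    columns, a shortest path in that graph links the supports of [a - a'] and
    [a + a'], and it yields previous columns [S] with
    [det(S, a - a') det(S, a + a') <> 0], i.e. [det(S, a)^2 <> det(S, a')^2]. *)

(** * Determinants with one column replaced *)

Section ReplaceColumn.
Variables (R : comPzRingType) (d : nat).
Implicit Types (M : 'M[R]_d) (m : 'I_d) (w : 'I_d -> R).

Definition set_col M m w : 'M[R]_d :=
  \matrix_(i, l) if l == m then w i else M i l.

Lemma det_set_col M m w :
  \det (set_col M m w) = \sum_i w i * cofactor M i m.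
Proof.
rewrite (expand_det_col _ m); apply: eq_bigr => i _.
rewrite mxE eqxx; congr (_ * (_ * \det _)).
by apply/matrixP => a b; rewrite !mxE eq_sym (negbTE (neq_lift _ _)).
Qed.

Lemma det_set_colD M m v w :
  \det (set_col M m (fun i => v i + w i)) =
  \det (set_col M m v) + \det (set_col M m w).
Proof.
by rewrite !det_set_col -big_split; apply: eq_bigr => i _; rewrite mulrDl.
Qed.

Lemma det_set_colB M m v w :
  \det (set_col M m (fun i => v i - w i)) =
  \det (set_col M m v) - \det (set_col M m w).
Proof.
by rewrite !det_set_col -sumrB; apply: eq_bigr => i _; rewrite mulrBl.
Qed.

End ReplaceColumn.

(** As [M] is diagonal, comparing row [m] of [M * adj M = det M * I] makes the cofactors of column
    [m] vanish outside row [m]. The constant [z] is the cofactor at [(m, m)], nonzero because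
    [k m * z = det M]. *)
Lemma det_set_col_diag (R : idomainType) (d : nat) (k : 'I_d -> R)
    (M : 'M[R]_d) (m : 'I_d) :
  (forall i l, M i l = k l *+ (i == l)) -> (forall l, k l != 0) ->
  exists2 z : R, z != 0 & forall w, \det (set_col M m w) = w m * z.
Proof.
move=> EM nzk.
have detM : \det M = \prod_l k l.
  have -> : M = diag_mx (\row_l k l).
    by apply/matrixP => i l; rewrite EM !mxE; case: eqP => [->|].
  by rewrite det_diag; apply: eq_bigr => l _; rewrite mxE.
have nzM : \det M != 0 by rewrite detM; apply/prodf_neq0.
have cofE i : k m * cofactor M i m = \det M *+ (m == i).
  have /matrixP/(_ m i) := mul_mx_adj M; rewrite !mxE => <-.
  rewrite (bigD1 m) //= EM eqxx mulr1n mxE big1 ?addr0 // => l ne_lm.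
  by rewrite EM eq_sym (negbTE ne_lm) mulr0n mul0r.
exists (cofactor M m m).
  have := cofE m; rewrite eqxx mulr1n => E.
  by apply: contraNneq nzM => E0; rewrite -E E0 mulr0.
move=> w'; rewrite det_set_col (bigD1 m) //= big1 ?addr0 // => i ne_im.
have /eqP := cofE i; rewrite [m == i]eq_sym (negbTE ne_im) mulr0n mulf_eq0.
by rewrite (negbTE (nzk m)) /= => /eqP ->; rewrite mulr0.
Qed.

Lemma single_term_eq0 (R : idomainType) (I : finType) (j : I) (p y : I -> R) :
  \sum_i p i * y i = 0 -> y j != 0 ->
  (forall i, i != j -> p i * y i = 0) -> p j = 0.
Proof.
move=> sum0 nzy other0; move: sum0.
rewrite (bigD1 j) //= big1 // addr0 => /eqP.
by rewrite mulf_eq0 (negbTE nzy) orbF => /eqP.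
Qed.

(** * Shortest walks in the support graph *)

Section SignEquivalence.
Variables (R : numDomainType) (d N : nat).
Implicit Types (Y : 'M[R]_(d, N)) (C : {set 'I_N}).

(* [r 0, c 0, r 1, ..., c (n-1), r n] is a walk through the bipartite support
   graph of the columns [C] of [Y], leading from the support of [u] to the
   support of [v]. *)
Definition linking_walk Y C (u v : 'I_d -> R) n
    (r : nat -> 'I_d) (c : nat -> 'I_N) : Prop :=
  [/\ u (r 0%N) != 0, v (r n) != 0
    & forall t, (t < n)%N ->
        [/\ c t \in C, Y (r t) (c t) != 0 & Y (r t.+1) (c t) != 0]].

(* A shortest linking walk is an induced path.  Its columns, completed by the
   unit columns [f0 l] of the rows [l] off the path and by one further column
   [w], form a matrix that is triangular (up to reordering) both for [w = u]
   and for [w = v]. *)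
Lemma no_linking_walk Y C (f0 : 'I_d -> 'I_N) (k u v : 'I_d -> R) :
  (forall l, f0 l \in C) ->
  (forall i l, Y i (f0 l) = k l *+ (i == l)) -> (forall l, k l != 0) ->
  (forall m (g : 'I_d -> 'I_N), (forall l, g l \in C) ->
     \det (set_col (colsub g Y) m u) * \det (set_col (colsub g Y) m v) = 0) ->
  forall n r c, ~ linking_walk Y C u v n r c.
Proof.
move=> f0C Ef0 nzk minors0; elim/ltn_ind => n IHn r c [ur0 vrn step].
(* Minimality of [n]: if [u] met a later row, the tail of the walk from that row would be shorter.
   Dually, [v] meets no row before the last. *)
have u0 s : (0 < s <= n)%N -> u (r s) = 0.
  move=> /andP[s_gt0 le_sn]; apply/eqP/negPn/negP => us.
  apply: (IHn (n - s)%N _ (fun t => r (t + s)%N) (fun t => c (t + s)%N)).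
    lia.
  by split=> [||t lt_t]; rewrite ?add0n ?subnK //; apply: step; lia.
have v0 s : (s < n)%N -> v (r s) = 0.
  move=> lt_sn; apply/eqP/negPn/negP => vs.
  by apply: (IHn s _ r c) => //; split=> // t lt_t; apply: step; lia.
(* Such a chord would let the walk go from [r s] through [c t] straight to [r t.+1], saving [t - s]
   steps. *)
have Yl s t : (s < t < n)%N -> Y (r s) (c t) = 0.
  move=> /andP[lt_st lt_tn]; apply/eqP/negPn/negP => Yst.
  pose r' x := r (if (x <= s)%N then x else x + (t - s))%N.
  pose c' x := c (if (x < s)%N then x else x + (t - s))%N.
  apply: (IHn (n - (t - s))%N _ r' c'); first lia.
  rewrite /r' /c'; split=> //.
    case: ifP => [|_]; first lia.
    by rewrite (_ : (_ + _)%N = n) //; lia.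
  move=> x lt_x; case: (ltngtP x s) => [lt_xs|lt_sx|->].
  - by apply: step; lia.
  - by rewrite addSn; apply: step; lia.
  - rewrite addSn subnKC; last lia.
    by have [? ? ?] := step t lt_tn.
(* Here the shortcut goes from [r t] through [c t] straight to [r s], saving [s - t.+1] steps. *)
have Yr s t : (t.+1 < s <= n)%N -> Y (r s) (c t) = 0.
  move=> /andP[lt_ts le_sn]; apply/eqP/negPn/negP => Yst.
  pose r' x := r (if (x <= t)%N then x else x + (s - t.+1))%N.
  pose c' x := c (if (x <= t)%N then x else x + (s - t.+1))%N.
  apply: (IHn (n - (s - t.+1))%N _ r' c'); first lia.
  rewrite /r' /c'; split=> //.
    case: ifP => [|_]; first lia.
    by rewrite (_ : (_ + _)%N = n) //; lia.
  move=> x lt_x; case: (ltngtP x t) => [lt_xs|lt_sx|->].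
  - by apply: step; lia.
  - by rewrite addSn; apply: step; lia.
  - rewrite subnKC; last lia.
    by have [|? ? ?] := step t; first lia.
(* A repetition [r s = r t] contradicts [Yl] at column [c t] if [t < n], and [v0] if [t = n]. *)
have r_inj s t : (s < t <= n)%N -> r s != r t.
  move=> /andP[lt_st le_tn]; apply/eqP => Est.
  have [|_ _] := step t.-1; first lia.
  rewrite prednK; last lia.
  rewrite -Est => Ys.
  have Es : s = t.-1.
    apply/eqP; rewrite -[_ == _]negbK; apply/negP => ne.
    by rewrite Yl ?eqxx // in Ys; lia.
  have [lt_tn|ge_tn] := ltnP t n.
    have [//|_ + _] := step t; rewrite -Est Yl ?eqxx //; lia.
  have Et : t = n by lia.
  by move: vrn; rewrite -Et -Est v0 ?eqxx //; lia.
(* A walk of [n] columns has [n.+1] rows: each [r t] with [t < n] receives [c t], and position [r n]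
   is left for the extra column [w]. *)
pose g l := if [pick t : 'I_n | r t == l] is Some t then c t else f0 l.
have gC l : g l \in C.
  by rewrite /g; case: pickP => [t _|//]; have [] := step t (ltn_ord t).
have gr t : (t < n)%N -> g (r t) = c t.
  move=> lt_t; rewrite /g; case: pickP => [t' /eqP Et'|/(_ (Ordinal lt_t))].
    case: (ltngtP t' t) => [lt|lt|-> //].
      by have := @r_inj t' t; rewrite lt Et' eqxx (ltnW lt_t) => /(_ isT).
    have := @r_inj t t'; rewrite lt Et' eqxx (ltnW (ltn_ord t')).
    by move/(_ isT).
  by rewrite eqxx.
have goff l : (forall t, (t <= n)%N -> r t != l) -> g l = f0 l.
  move=> off; rewrite /g; case: pickP => // t /eqP Et.
  by have := off t (ltnW (ltn_ord t)); rewrite Et eqxx.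
have onoff l : (exists2 t, (t <= n)%N & l = r t) \/
               (forall t, (t <= n)%N -> r t != l).
  have [/existsP[t /eqP Et]|/existsPn off] :=
      boolP [exists t : 'I_n.+1, r t == l].
    by left; exists t => //; rewrite -ltnS.
  by right=> t le_t; apply: (off (Ordinal (le_t : (t < n.+1)%N))).
pose m := r n.
(* Nonvanishing of the determinant is tested on left kernel vectors [psi]. The columns [f0 l],
   multiples of unit vectors, kill [psi] off the path; the path columns and [w] constrain the
   rest. *)
have cols w (psi : 'rV[R]_d) : psi *m set_col (colsub g Y) m w = 0 ->
  [/\ forall l, (forall t, (t <= n)%N -> r t != l) -> psi 0 l = 0,
      forall t, (t < n)%N -> \sum_i psi 0 i * Y i (c t) = 0
    & \sum_i psi 0 i * w i = 0].
  move=> /rowP E.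
  have E1 l : l != m -> \sum_i psi 0 i * Y i (g l) = 0.
    move=> ne; have := E l; rewrite !mxE; apply: etrans; apply: eq_bigr => i _.
    by rewrite !mxE (negbTE ne).
  split.
  - move=> l off; have ne : l != m by rewrite eq_sym; apply: off.
    have := E1 l ne; rewrite goff // => /(@single_term_eq0 _ _ l); apply.
      by rewrite Ef0 eqxx nzk.
    by move=> i ne_il; rewrite Ef0 (negbTE ne_il) mulr0.
  - move=> t lt_t; rewrite -gr //; apply: E1; apply: r_inj; lia.
  - have := E m; rewrite !mxE; apply: etrans; apply: eq_bigr => i _.
    by rewrite !mxE eqxx.
have /eqP := minors0 m g gC; apply/negP; rewrite mulf_neq0 //.
(* For [w = u], go up the path: [u] meets it only in [r 0], and by [Yr] column [c t] determines
   [psi] at [r t.+1] from the earlier rows. *)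
- apply/det0P => -[psi /negP nz /cols[off col last]]; apply: nz.
  suff on t : (t <= n)%N -> psi 0 (r t) = 0.
    apply/eqP/rowP => l; rewrite mxE.
    by have [[t le_t ->]|/off] := onoff l; first exact: on.
  elim/ltn_ind: t => -[_ _|t IHt le_t].
    apply: (single_term_eq0 last) => // i ne_i.
    have [[[|s] le_s Es]|/off ->] := onoff i; last by rewrite mul0r.
      by rewrite Es eqxx in ne_i.
    by rewrite Es u0 ?mulr0.
  have [_ _ nzY] := step t le_t.
  apply: (single_term_eq0 (col t le_t)) => // i ne_i.
  have [[s le_s Es]|/off ->] := onoff i; last by rewrite mul0r.
  have [le_st|lt_ts] := leqP s t; first by rewrite Es IHt ?mul0r //; lia.
  have ne_st : s != t.+1 by apply: contraNneq ne_i => <-; rewrite Es.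
  by rewrite Es Yr ?mulr0 //; lia.
(* For [w = v], go down from [r n]: by [Yl] column [c t] meets no path row before [r t], so it
   determines [psi] at [r t] from the later rows. *)
- apply/det0P => -[psi /negP nz /cols[off col last]]; apply: nz.
  suff on t : (t <= n)%N -> psi 0 (r (n - t)%N) = 0.
    apply/eqP/rowP => l; rewrite mxE.
    have [[t le_t ->]|/off //] := onoff l.
    by rewrite -(subKn le_t); apply: on; lia.
  elim/ltn_ind: t => -[_ _|t IHt le_t].
    rewrite subn0; apply: (single_term_eq0 last) => // i ne_i.
    have [[s le_s Es]|/off ->] := onoff i; last by rewrite mul0r.
    have ne_sn : s != n by apply: contraNneq ne_i => <-; rewrite Es.
    by rewrite Es v0 ?mulr0 //; lia.
  have lt_t : (n - t.+1 < n)%N by lia.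
  have [_ nzY _] := step _ lt_t.
  apply: (single_term_eq0 (col _ lt_t)) => // i ne_i.
  have [[s le_s Es]|/off ->] := onoff i; last by rewrite mul0r.
  have [le_st|lt_ts] := leqP s (n - t.+1); last first.
    rewrite Es -(subKn le_s) IHt ?mul0r //; lia.
  have ne_st : s != (n - t.+1)%N by apply: contraNneq ne_i => <-; rewrite Es.
  by rewrite Es Yl ?mulr0 //; lia.
Qed.

Definition adjacent Y C : rel 'I_d :=
  fun i k => [exists j in C, (Y i j != 0) && (Y k j != 0)].

Lemma connect_linking_walk Y C (u v : 'I_d -> R) (j : 'I_N) i k :
  connect (adjacent Y C) i k -> u i != 0 -> v k != 0 ->
  exists n r c, linking_walk Y C u v n r c.
Proof.
move=> /connectP[p pth ->] {k} ui vk.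
suff [r [c [r0 rn step]]] : exists r c, [/\ r 0%N = i, r (size p) = last i p
    & forall t, (t < size p)%N ->
        [/\ c t \in C, Y (r t) (c t) != 0 & Y (r t.+1) (c t) != 0]].
  by exists (size p), r, c; split; rewrite ?r0 ?rn.
elim: p i pth {ui vk} => [|k p IHp] i /=.
  (* The trivial path uses no column; [j] serves as the default value of [c]. *)
  by move=> _; exists (fun=> i), (fun=> j).
move=> /andP[/existsP[c0 /and3P[c0C Yi Yk]] /IHp[r [c [r0 rn step]]]].
exists (fun t => if t is t'.+1 then r t' else i).
exists (fun t => if t is t'.+1 then c t' else c0).
by split=> // -[_|t lt_t]; [rewrite r0 | apply: step].
Qed.

(** * Matrices whose maximal minors agree up to sign *)

Definition is_sign (x : R) := (x == 1) || (x == -1).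

Lemma sign_sqr x : is_sign x -> x ^+ 2 = 1.
Proof. by case/orP=> /eqP ->; rewrite ?sqrrN expr1n. Qed.

Lemma is_signM x y : is_sign x -> is_sign y -> is_sign (x * y).
Proof.
rewrite /is_sign; case/orP=> /eqP ->; case/orP=> /eqP ->;
by rewrite ?mulN1r ?mul1r ?opprK !eqxx ?orbT.
Qed.

Lemma is_sign_if (b : bool) : is_sign (if b then -1 else 1).
Proof. by rewrite /is_sign; case: b; rewrite eqxx ?orbT. Qed.

(** Squares express equality up to sign in a form whose difference factors, which is what produces
    the product of the minors with [u] and [v]. *)
Definition same_abs_minors Y Y' :=
  forall f : 'I_d -> 'I_N, \det (colsub f Y) ^+ 2 = \det (colsub f Y') ^+ 2.

Definition sign_equiv_on C Y Y' :=
  exists (r : 'I_d -> R) (c : 'I_N -> R),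
    [/\ forall i, is_sign (r i), forall j, is_sign (c j)
      & forall i j, j \in C -> Y' i j = r i * c j * Y i j].

(** Flip the rows in the components [K] that meet the support of [u], together with the columns of
    [C] that meet [K]. Columns of [C] are unchanged, since the support of each lies in one
    component. On column [j0], no walk links [u] to [v], so [v = 0] on [K], while [u = 0] off
    [K]. *)
Lemma sign_equiv_extend Y Y' C (f0 : 'I_d -> 'I_N) (k : 'I_d -> R) (j0 : 'I_N) :
  (forall l, f0 l \in C) ->
  (forall i l, Y i (f0 l) = k l *+ (i == l)) -> (forall l, k l != 0) ->
  same_abs_minors Y Y' ->
  (forall i j, j \in C -> Y' i j = Y i j) ->
  sign_equiv_on (j0 |: C) Y Y'.
Proof.
move=> f0C Ef0 nzk minE agree.
have [j0C|j0C] := boolP (j0 \in C).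
  exists (fun=> 1), (fun=> 1); split=> [i|j|i j]; rewrite /is_sign ?eqxx //.
  rewrite in_setU1 !mul1r => /predU1P[->|]; exact: agree.
pose u i := Y i j0 - Y' i j0; pose v i := Y i j0 + Y' i j0.
have minors m (g : 'I_d -> 'I_N) : (forall l, g l \in C) ->
    \det (set_col (colsub g Y) m u) * \det (set_col (colsub g Y) m v) = 0.
  move=> gC; rewrite det_set_colB det_set_colD -subr_sqr.
  apply/eqP; rewrite subr_eq0; apply/eqP.
  pose f l := if l == m then j0 else g l.
  have -> : set_col (colsub g Y) m (fun i => Y i j0) = colsub f Y.
    by apply/matrixP => i l; rewrite !mxE /f; case: (l == m).
  rewrite minE; congr (\det _ ^+ 2).
  by apply/matrixP => i l; rewrite !mxE /f; case: (l == m) => //; rewrite agree.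
have sqE i : Y i j0 ^+ 2 = Y' i j0 ^+ 2.
  have [|//|z nz detE] := @det_set_col_diag _ _ k (colsub f0 Y) i.
    by move=> i' l; rewrite mxE Ef0.
  have /eqP := minors i f0 f0C; rewrite !detE !mulf_eq0 (negbTE nz) !orbF.
  by rewrite -mulf_eq0 -subr_sqr subr_eq0 => /eqP.
have uv i : (u i == 0) || (v i == 0).
  by rewrite -mulf_eq0 -subr_sqr subr_eq0 sqE.
pose K i := [exists k, connect (adjacent Y C) k i && (u k != 0)].
(* Column [j0] keeps the sign 1, so that the row signs alone turn it into that of [Y']. *)
pose c j := if (j != j0) && [exists i, K i && (Y i j != 0)] then -1 else 1 : R.
exists (fun i => if K i then -1 else 1), c; split.
- by move=> i; apply: is_sign_if.
- by move=> j; apply: is_sign_if.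
move=> i j; rewrite in_setU1 => /predU1P[->|jC].
  rewrite /c eqxx mulr1; case: ifP => [/existsP[l /andP[li ul]]|/existsPn noK].
    rewrite mulN1r; apply/eqP; rewrite -addr_eq0 addrC -/(v i).
    apply/negPn/negP => vi.
    have [n [r [c' walk]]] := connect_linking_walk j0 li ul vi.
    exact: (no_linking_walk f0C Ef0 nzk minors walk).
  have := noK i; rewrite connect0 negbK subr_eq0 => /eqP ->.
  by rewrite mul1r.
rewrite agree // /c (_ : j != j0); last by apply: contraNneq j0C => <-.
have [->|nzY] := eqVneq (Y i j) 0; first by rewrite mulr0.
rewrite (_ : [exists i, _] = K i); last first.
  apply/existsP/idP => [[i' /andP[Ki' nzY']]|Ki]; last by exists i; rewrite Ki.
  have /existsP[l /andP[li ul]] := Ki'; apply/existsP; exists l; rewrite ul.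
  rewrite (connect_trans li) // connect1 //; apply/existsP; exists j.
  by rewrite jC nzY nzY'.
by case: (K i); rewrite /= ?mulrNN mulr1 mul1r.
Qed.

Lemma sign_equiv_of_abs_minors Y Y' (f0 : 'I_d -> 'I_N) (k : 'I_d -> R) :
  (forall i l, Y i (f0 l) = k l *+ (i == l)) -> (forall l, k l != 0) ->
  (forall i l, Y' i (f0 l) = Y i (f0 l)) ->
  same_abs_minors Y Y' ->
  sign_equiv_on setT Y Y'.
Proof.
move=> Ef0 nzk Ef0' minE; pose C0 := f0 @: setT.
suff [C sC0 EC] : exists2 C : {set 'I_N},
    C0 \subset C & #|~: C| = 0%N /\ sign_equiv_on C Y Y'.
  case: EC => /eqP; rewrite cards_eq0 => /eqP EC.
  by rewrite -(setCK C) EC setC0.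
(* Here [n] counts the columns already adjoined to the diagonal block. *)
suff ind n : (n <= #|~: C0|)%N -> exists2 C : {set 'I_N},
    C0 \subset C & #|~: C| = (#|~: C0| - n)%N /\ sign_equiv_on C Y Y'.
  by have [//|C] := ind #|~: C0|; rewrite subnn; exists C.
elim: n => [_|n IHn lt_n].
  exists C0 => //; split; first by rewrite subn0.
  exists (fun=> 1), (fun=> 1); split=> [i|j|i j]; rewrite /is_sign ?eqxx //.
  by case/imsetP=> l _ ->; rewrite Ef0' !mul1r.
have [|C sC0 [cardC [r [c [rs cs EY']]]]] := IHn; first lia.
have /card_gt0P[j0 j0C] : (0 < #|~: C|)%N by rewrite cardC; lia.
exists (j0 |: C); first exact: subset_trans sC0 (subsetUr _ _).
split.
  have := cardsC C; have := cardsC (j0 |: C); rewrite cardsU1.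
  by rewrite inE in j0C; rewrite j0C; lia.
(* Signs are their own inverses, so applying those found so far to [Y'] makes it equal to [Y] on
   [C], as the extension step requires. *)
pose Y'' : 'M_(d, N) := \matrix_(i, j) (r i * c j * Y' i j).
have minE'' : same_abs_minors Y Y''.
  move=> f; rewrite minE.
  have -> : colsub f Y'' = diag_mx (\row_i r i) *m colsub f Y'
      *m diag_mx (\row_l c (f l)).
    by apply/matrixP => i l; rewrite mul_mx_diag mul_diag_mx !mxE mulrAC.
  have det_sign n' (x : 'rV[R]_n') : (forall i, is_sign (x 0 i)) ->
      \det (diag_mx x) ^+ 2 = 1.
    move=> xs; rewrite det_diag -prodrXl big1 // => i _; exact: sign_sqr.
  by rewrite !det_mulmx !exprMn !det_sign ?mulr1 ?mul1r // => i; rewrite mxE.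
have [||r' [c' [rs' cs' EY'']]] :=
    @sign_equiv_extend Y Y'' C f0 k j0 _ Ef0 nzk minE''.
- by move=> l; apply: (subsetP sC0); apply: imset_f.
- move=> i j jC; rewrite mxE EY' // mulrA -mulrACA.
  by rewrite -!expr2 !sign_sqr ?mulr1 ?mul1r.
exists (fun i => r i * r' i), (fun j => c j * c' j); split=> [i|j|i j jC].
- exact: is_signM.
- exact: is_signM.
have := EY'' i j jC; rewrite mxE => E.
rewrite /= mulrACA -[_ * Y i j]mulrA -E mulrA mulrACA -!expr2 !sign_sqr //.
by rewrite !mul1r.
Qed.

End SignEquivalence.

(** * Multiplicities as determinants and contents *)

Section Multiplicity.
Variables (d N : nat).
Implicit Types (X : 'M[int]_(d, N)) (S : {set 'I_N}) (v w : 'cV[int]_d).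

Lemma in_latticeB X S v w :
  in_lattice X S v -> in_lattice X S w -> in_lattice X S (v - w).
Proof.
move=> [a ->] [b ->]; exists (fun e => a e - b e).
by rewrite -sumrB; apply: eq_bigr => e _; rewrite scalerBl.
Qed.

Lemma mult_leq X S k k' : mult X S k -> mult X S k' -> (k <= k')%N.
Proof.
move=> [p [satp injp _]] [q [_ _ surjq]].
have [h hP] := fin_all_exists (fun i => surjq _ (satp i)).
rewrite -(card_ord k) -(card_ord k'); apply: (leq_card h) => i j Eh.
apply: injp; have := in_latticeB (hP i) (hP j).
by rewrite Eh opprB addrA subrK.
Qed.

Lemma mult_unique X S k k' : mult X S k -> mult X S k' -> k = k'.
Proof. by move=> mk mk'; apply/eqP; rewrite eqn_leq !(@mult_leq X S). Qed.

Lemma mult_card X S (T : finType) (reps : T -> 'cV[int]_d) :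
  (forall t, in_saturation X S (reps t)) ->
  (forall t t', in_lattice X S (reps t - reps t') -> t = t') ->
  (forall v, in_saturation X S v -> exists t, in_lattice X S (v - reps t)) ->
  mult X S #|T|.
Proof.
move=> sat inj surj; exists (reps \o enum_val); split=> [i|i j|v].
- exact: sat.
- by move/inj/enum_val_inj.
- by move/surj=> [t tP]; exists (enum_rank t); rewrite /= enum_rankK.
Qed.

Lemma in_lattice_imset X (f : 'I_d -> 'I_N) v : injective f ->
  in_lattice X (f @: setT) v <-> exists z : 'cV_d, v = colsub f X *m z.
Proof.
move=> injf; split=> [[c ->]|[z ->]].
  exists (\col_l c (f l)); apply/colP => i.
  rewrite big_imset /=; last by move=> ? ? _ _; apply: injf.
  rewrite summxE !mxE; under eq_bigl do rewrite inE.
  by apply: eq_bigr => l _; rewrite !mxE mulrC.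
(* By injectivity this sum has a single term on the image of [f], and it is 0 elsewhere: it
   transports [z] along the inverse of [f]. *)
exists (fun e => \sum_(l | f l == e) z l 0); apply/colP => i.
rewrite big_imset /=; last by move=> ? ? _ _; apply: injf.
rewrite summxE !mxE; under [RHS]eq_bigl do rewrite inE.
apply: eq_bigr => l _; rewrite !mxE mulrC (big_pred1 l) // => l'.
by rewrite (inj_eq injf).
Qed.

Lemma map_intRE m n (A : 'M[int]_(m, n)) : map_mx intR A = map_mx intr A.
Proof. by []. Qed.

Lemma colsR_imset X n (f : 'I_n -> 'I_N) :
  (colsR X (f @: setT) :=: map_mx intR (colsub f X)^T)%MS.
Proof.
apply/eqmxP/andP; split; apply/row_subP => i.
  have [/imsetP[l _ ->]|off] := boolP (i \in f @: setT).
    apply: (eq_row_sub (l)); apply/rowP => j; rewrite !mxE.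
    by rewrite imset_f.
  rewrite (_ : row i _ = 0) ?sub0mx //.
  by apply/rowP => j; rewrite !mxE (negbTE off).
apply: (eq_row_sub (f i)); apply/rowP => j; rewrite !mxE.
by rewrite imset_f.
Qed.

Lemma arank_imset X n (f : 'I_n -> 'I_N) :
  arank X (f @: setT) = \rank (map_mx intR (colsub f X)).
Proof. by rewrite /arank colsR_imset -map_trmx mxrank_tr. Qed.

Lemma arank_imset_full X (f : 'I_d -> 'I_N) :
  (arank X (f @: setT) == d) = (\det (colsub f X) != 0).
Proof.
rewrite arank_imset -[_ == d]/(row_full _).
by rewrite row_full_unit unitmxE map_intRE det_map_mx unitfE intr_eq0.
Qed.

Lemma absz_unit (x : int) : x \is a GRing.unit -> `|x|%N = 1%N.
Proof.
by move=> /mulrV/(congr1 absz)/eqP; rewrite abszM muln_eq1 => /andP[/eqP].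
Qed.

(** The saturation is all of the ambient lattice. A Smith form [L D Q] identifies the quotient with
    the product of the cyclic groups of order [|delta_i|], and the product of these orders is the
    absolute determinant. *)
Lemma mult_det X (f : 'I_d -> 'I_N) : injective f -> \det (colsub f X) != 0 ->
  mult X (f @: setT) `|\det (colsub f X)|.
Proof.
move=> injf nzdet.
have sat v : in_saturation X (f @: setT) v.
  by apply: submx_full; rewrite /row_full [_ == _]arank_imset_full.
have [L unitL [Q unitQ [delta _ EX]]] := int_Smith_normal_form (colsub f X).
pose D := diag_mx (\row_i delta`_i) : 'M[int]_d.
have {}EX : colsub f X = L *m D *m Q.
  rewrite EX; congr (_ *m _ *m _); apply/matrixP => i j; rewrite !mxE.
  by case: (i =P j) => [->|/eqP/negbTE ne]; rewrite ?eqxx //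
     (_ : _ == _ = false).
have detE : `|\det (colsub f X)|%N = (\prod_(i < d) absz (delta`_i)%R)%N.
  rewrite EX !det_mulmx !abszM (absz_unit unitL) (absz_unit unitQ).
  rewrite mul1n muln1 det_diag (big_morph absz abszM (erefl _)).
  by apply: eq_bigr => i _; rewrite mxE.
have delta_gt0 i : (i < d)%N -> (0 < absz (delta`_i)%R)%N.
  move=> lt_i; have : (`|\det (colsub f X)| != 0)%N by rewrite absz_eq0.
  rewrite detE (bigD1 (Ordinal lt_i)) //= muln_eq0 negb_or => /andP[+ _].
  by rewrite lt0n.
have latE v : in_lattice X (f @: setT) v <->
    forall i : 'I_d, ((delta`_i)%R %| ((invmx L *m v) i 0)%R)%Z.
  rewrite in_lattice_imset // EX; split=> [[z ->] i|dv].
    rewrite -!mulmxA mulKmx // mul_diag_mx !mxE; exact: dvdz_mulr.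
  exists (invmx Q *m \col_i (((invmx L *m v) i 0)%R %/ (delta`_i)%R)%Z).
  rewrite -mulmxA mulKVmx // -mulmxA -[LHS](mulKVmx unitL); congr (_ *m _).
  apply/colP => i; rewrite mul_diag_mx !mxE mulrC divzK //.
  by have := dv i; rewrite !mxE.
have cardT : #|{dffun forall i : 'I_d, 'I_(absz (delta`_i)%R)}| =
    `|\det (colsub f X)|%N.
  rewrite card_dep_ffun detE foldrE big_map big_enum /=.
  by apply: eq_bigr => i _; rewrite card_ord.
rewrite -cardT.
(* In the basis given by the columns of [L], a coset is represented by its vector of residues modulo
   [|delta_i|]. *)
pose reps (t : {dffun forall i : 'I_d, 'I_(absz (delta`_i)%R)}) : 'cV[int]_d :=
  L *m \col_i (t i : nat)%:Z.
apply: (@mult_card _ _ _ reps) => [//|t t'|v _].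
  move/latE => dv; apply/ffunP => i; apply/val_inj/eqP.
  have := dv i; rewrite mulmxBr !mulKmx // !mxE -eqz_mod_dvd.
  rewrite -modz_abs -[X in _ == X]modz_abs !modz_nat !modn_small ?ltn_ord //.
have lt_mod i :
    (`|(((invmx L *m v) i 0)%R %% (delta`_i)%R)%Z| < absz (delta`_i)%R)%N.
  rewrite -ltz_nat gez0_abs ?modz_ge0 -?absz_gt0 ?delta_gt0 //.
  by rewrite ltz_mod // -absz_gt0 delta_gt0.
exists [ffun i => Ordinal (lt_mod i)]; apply/latE => i.
rewrite mulmxBr mulKmx // mxE [X in (_ %| _ + X)%Z]mxE.
rewrite [X in (_ %| _ - X)%Z]mxE ffunE /=.
rewrite gez0_abs ?modz_ge0 -?absz_gt0 ?delta_gt0 //.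
by rewrite -eqz_mod_dvd modz_mod.
Qed.

Lemma in_lattice_set1 X e v :
  in_lattice X [set e] v <-> exists c : int, v = c *: col e X.
Proof.
split=> [[c ->]|[c ->]]; first by exists (c e); rewrite big_set1.
by exists (fun=> c); rewrite big_set1.
Qed.

Lemma in_saturation_set1 X e v :
  in_saturation X [set e] v <->
  exists a : RR, forall i, (v i 0)%:~R = a * (X i e)%:~R.
Proof.
have E : (colsR X [set e] :=: map_mx intR (col e X)^T)%MS.
  apply/eqmxP/andP; split.
    apply/row_subP => i; have [->|ne] := eqVneq i e.
      apply: (eq_row_sub (0)); apply/rowP => j; rewrite !mxE.
      by rewrite inE eqxx.
    rewrite (_ : row i _ = 0) ?sub0mx //.
    by apply/rowP => j; rewrite !mxE inE (negbTE ne).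
  apply: (eq_row_sub (e)); apply/rowP => j; rewrite !mxE.
  by rewrite inE eqxx.
rewrite /in_saturation E; split=> [/sub_rVP[a /rowP Ea]|[a Ea]].
  by exists a => i; have := Ea i; rewrite !mxE.
by apply/sub_rVP; exists a; apply/rowP => i; rewrite !mxE; apply: Ea.
Qed.

(** The Smith form of a single column writes it as [a *: p], with [p] the first column of a
    unimodular matrix. Then the saturation is generated by [p] and the lattice by [a *: p], so the
    index is [|a|]. *)
Lemma mult_set1 X e : col e X != 0 ->
  exists (g : nat) (p : 'cV[int]_d),
    [/\ (0 < g)%N, mult X [set e] g & col e X = g%:Z *: p].
Proof.
move=> nz; have [i0 _] : exists i, X i e != 0.
  apply/existsP; rewrite -negb_forall; apply: contra nz => /forallP z.
  by apply/eqP/colP => i; rewrite !mxE; apply/eqP/z.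
pose o : 'I_d := Ordinal (leq_ltn_trans (leq0n i0) (ltn_ord i0)).
have [L unitL [Q unitQ [delta _ EX]]] := int_Smith_normal_form (col e X).
pose p := col o L; pose a := delta`_0 * Q 0 0.
have Ecol : col e X = a *: p.
  rewrite EX; apply/colP => i; rewrite !mxE big_ord1 mxE (bigD1 o) //=.
  rewrite !mxE eqxx mulr1n big1 ?addr0; first by rewrite -mulrA mulrC.
  move=> j ne; rewrite mxE (_ : (_ == _) = false) ?mulr0 //.
  by apply: contraNF ne => /eqP Ej; apply/eqP/val_inj.
clearbody a.
have XE i : X i e = a * p i 0 by have /colP/(_ i) := Ecol; rewrite !mxE.
have nza : a != 0 by apply: contraNneq nz => a0; rewrite Ecol a0 scale0r.
(* The row [y] certifies that [p] is primitive: pairing with [y] recovers the coefficient of any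
   multiple of [p], and this coefficient is an integer when the multiple is an integer vector. *)
pose y : 'rV[int]_d := row o (invmx L).
have yp : \sum_i y 0 i * p i 0 = 1.
  have /matrixP/(_ o o) := mulVmx unitL; rewrite !mxE eqxx => E.
  by rewrite -[RHS]E; apply: eq_bigr => i _; rewrite !mxE.
have p_inj (z z' : int) : z *: p = z' *: p -> z = z'.
  move=> /colP E; rewrite -[z]mulr1 -[z']mulr1 -yp !mulr_sumr.
  apply: eq_bigr => i _; have := E i.
  by rewrite !mxE !(mulrCA _ (invmx L o i)) => ->.
have ypR : \sum_i (y 0 i * p i 0)%:~R = 1 :> RR.
  by rewrite -(rmorph_sum intr) /= yp.
have satP v : in_saturation X [set e] v <-> exists z : int, v = z *: p.
  rewrite in_saturation_set1; split=> [[b Eb]|[z ->]].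
    exists (\sum_i y 0 i * v i 0); apply/colP => j; rewrite mxE.
    apply: (@intr_inj RR); rewrite Eb XE !intrM rmorph_sum /= mulrA.
    congr (_ * _); rewrite -[LHS]mulr1 -[X in _ * X = _]ypR mulr_sumr.
    by apply: eq_bigr => i _ /=; rewrite !intrM Eb XE intrM; ring.
  exists (z%:~R / a%:~R) => i; rewrite XE mxE !intrM mulrA divfK //.
  by rewrite intr_eq0.
have latP v : in_lattice X [set e] v <-> exists c : int, v = (c * a) *: p.
  by rewrite in_lattice_set1 Ecol; split=> -[c ->]; exists c; rewrite scalerA.
(* The content is a natural number, so the sign of [a] goes into the primitive vector. *)
exists `|a|%N, (Num.sg a *: p); split; first by rewrite absz_gt0.
- rewrite -[X in mult _ _ X]card_ord.
  apply: (@mult_card _ _ _ (fun i : 'I_`|a| => (i : nat)%:Z *: p)) => [i|i j|v].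
  + by apply/satP; exists (i : nat)%:Z.
  + move=> /latP[c]; rewrite -scalerBl => /p_inj E.
    apply/val_inj/eqP; rewrite /= -[_ == _]/((i : nat)%:Z == (j : nat)%:Z).
    have : (a %| (i : nat)%:Z - (j : nat)%:Z)%Z by rewrite E dvdz_mull.
    rewrite -eqz_mod_dvd -modz_abs -[X in _ == X]modz_abs.
    by rewrite !modz_nat !modn_small ?ltn_ord.
  + move=> /satP[z ->].
    have lt_mod : (`|(z %% a)%Z| < `|a|)%N.
      by rewrite -ltz_nat gez0_abs ?modz_ge0 // ltz_mod.
    exists (Ordinal lt_mod); apply/latP; exists (z %/ a)%Z.
    rewrite /= gez0_abs ?modz_ge0 // -scalerBl; congr (_ *: _).
    by rewrite {1}(divz_eq z a) addrK.
- by rewrite scalerA Ecol abszE normrEsg mulrAC -expr2 sqr_sg nza mul1r.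
Qed.

(** The rank decides whether a minor with distinct columns vanishes, and a nonzero one is a
    multiplicity up to sign. A repeated column makes both minors 0. *)
Lemma same_arith_abs_det X X' : same_arith_matroid X X' ->
  forall f : 'I_d -> 'I_N,
    `|\det (colsub f X)|%N = `|\det (colsub f X')|%N.
Proof.
move=> same f; have [injf|] := boolP (injectiveb f); last first.
  case/injectivePn => i [j ne_ij Ef].
  have det0 (Y : 'M[int]_(d, N)) : \det (colsub f Y) = 0.
    rewrite -det_tr; apply: (determinant_alternate ne_ij) => l.
    by rewrite !mxE Ef.
  by rewrite !det0.
move/injectiveP in injf; have [Erk Em] := same (f @: setT).
have := arank_imset_full X f; rewrite Erk arank_imset_full.
have [-> /esym/negbFE/eqP -> //|nz' /esym nz] := eqVneq (\det (colsub f X')) 0.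
apply: (@mult_unique X' (f @: setT)); last exact: mult_det.
by apply/Em; apply: mult_det.
Qed.

(** Dividing each column by its content leaves an integer matrix [P]. The absolute determinant is
    the product of the contents times [|det P|], and multiplicativity makes it equal to that
    product, so [|det P| = 1]. *)
Lemma basis_factorization X (f : 'I_d -> 'I_N) (k : 'I_d -> nat) :
  injective f -> \det (colsub f X) != 0 ->
  (forall l, mult X [set f l] (k l)) ->
  mult X (f @: setT) (\prod_l k l) ->
  (forall l, 0 < k l)%N /\
  exists2 P : 'M[int]_d, P \in unitmx &
    colsub f X = P *m diag_mx (\row_l (k l)%:Z).
Proof.
move=> injf nzdet mk mB.
have col_div l : exists p : 'cV[int]_d,
    (0 < k l)%N /\ col (f l) X = (k l)%:Z *: p.
  have nzc : col (f l) X != 0.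
    apply: contraNneq nzdet => /colP z; rewrite (expand_det_col _ l) big1 //.
    by move=> i _; have := z i; rewrite !mxE => ->; rewrite mul0r.
  have [g [p [g_gt0 mg Eg]]] := mult_set1 nzc.
  by exists p; rewrite (mult_unique (mk l) mg).
have [p pP] := fin_all_exists col_div.
have k_gt0 l : (0 < k l)%N by have [] := pP l.
split=> //; pose P : 'M[int]_d := \matrix_(i, l) p l i 0.
have EX : colsub f X = P *m diag_mx (\row_l (k l)%:Z).
  apply/matrixP => i l; have [_ /colP/(_ i)] := pP l.
  by rewrite mul_mx_diag !mxE mulrC.
exists P => //; have := mult_unique (mult_det injf nzdet) mB.
rewrite EX det_mulmx abszM det_diag (big_morph absz abszM (erefl _)).
under eq_bigr do rewrite mxE /=.
rewrite -[RHS]mul1n => /eqP; rewrite eqn_pmul2r ?prodn_gt0 // => /eqP E.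
by rewrite unitmxE; move: E; case: (\det P) => -[|[|n]].
Qed.

End Multiplicity.

(** * Reduction to a common diagonal block *)

Unset Implicit Arguments.

Theorem theorem1p1 (d N : nat) (X X' : 'M[int]_(d, N)) :
  (0 < d)%N -> (d <= N)%N ->
  \rank (map_mx intR X) = d -> \rank (map_mx intR X') = d ->
  same_arith_matroid X X' ->
  weakly_multiplicative X ->
  exists (T : 'M[int]_d) (eps : 'rV[int]_N),
    [/\ T \in unitmx,
        (forall i, eps 0 i = 1 \/ eps 0 i = -1)
      & X' = T *m X *m diag_mx eps].
Proof.
move=> _ _ rkX _ same [B [[rkB rkT] [mB [mx [mBP mxP Em]]]]].
have rkTd : arank X setT = d.
  have <- : id @: [set: 'I_N] = setT by rewrite imset_id.
  rewrite arank_imset -[RHS]rkX; congr (\rank (map_mx _ _)).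
  by apply/matrixP => i j; rewrite mxE.
have cardB : #|B| = d by rewrite -rkB rkT.
pose f l : 'I_N := enum_val (cast_ord (esym cardB) l).
have injf : injective f by move=> l l' /enum_val_inj/cast_ord_inj.
have fB : f @: setT = B.
  apply/eqP; rewrite eqEcard card_imset // cardsT card_ord cardB leqnn andbT.
  by apply/subsetP => _ /imsetP[l _ ->]; apply: enum_valP.
have nzdet : \det (colsub f X) != 0.
  by rewrite -arank_imset_full fB rkT rkTd.
have absE := same_arith_abs_det same.
have nzdet' : \det (colsub f X') != 0 by rewrite -absz_eq0 -absE absz_eq0.
pose k l := mx (f l).
have mk l : mult X [set f l] (k l) by apply: mxP; rewrite enum_valP.
have mBk : mult X (f @: setT) (\prod_l k l).
  rewrite fB; suff <- : mB = \prod_l k l by [].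
  rewrite Em -fB big_imset /=; last by move=> ? ? _ _; apply: injf.
  by under eq_bigl do rewrite inE.
have [k_gt0 [P unitP EP]] := basis_factorization injf nzdet mk mBk.
have [||_ [P' unitP' EP']] := basis_factorization (X := X') (k := k) injf nzdet'.
- by move=> l; apply/(proj2 (same _)).
- by apply/(proj2 (same _)).
(* Both matrices now have the same diagonal block on the basis, and unimodular factors change the
   maximal minors only by a sign. *)
pose Y := invmx P *m X; pose Y' := invmx P' *m X'.
have colsubM (A : 'M[int]_d) (Z : 'M[int]_(d, N)) (g : 'I_d -> 'I_N) :
    colsub g (A *m Z) = A *m colsub g Z.
  by apply/matrixP => i l; rewrite !mxE; apply: eq_bigr => j _; rewrite !mxE.
have YE : colsub f Y = diag_mx (\row_l (k l)%:Z).
  by rewrite colsubM EP mulKmx.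
have Y'E : colsub f Y' = diag_mx (\row_l (k l)%:Z).
  by rewrite colsubM EP' mulKmx.
have minE : same_abs_minors Y Y'.
  move=> g; apply/eqP; rewrite eqf_sqr -eqr_norm2 -!abszE eqz_nat !colsubM.
  have abs1 A : A \in unitmx -> `|\det (invmx A)|%N = 1%N :> nat.
    by move=> unitA; apply: absz_unit; rewrite -unitmxE unitmx_inv.
  by rewrite !det_mulmx !abszM absE !abs1.
have [||i l|r [c [rs cs E]]] := sign_equiv_of_abs_minors
    (f0 := f) (k := fun l => (k l)%:Z) _ _ _ minE.
- by move=> i l; have /matrixP/(_ i l) := YE; rewrite !mxE; case: eqP => [->|].
- by move=> l; rewrite -lt0n.
- by have /matrixP/(_ i l) := YE; rewrite -Y'E !mxE => ->.
(* Read off from [X' = P' Y'], [Y' = diag(r) Y diag(c)] and [Y = P^-1 X]. *)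
exists (P' *m diag_mx (\row_i r i) *m invmx P), (\row_j c j); split.
- rewrite !unitmx_mul unitP' unitmx_inv unitP andbT /= unitmxE det_diag.
  by apply: rpred_prod => i _; rewrite mxE; case/orP: (rs i) => /eqP ->.
- by move=> j; rewrite mxE; case/orP: (cs j) => /eqP ->; [left|right].
rewrite -!mulmxA -[LHS](mulKVmx unitP'); congr (_ *m _).
rewrite -/Y' (mulmxA _ X) -/Y mulmxA; apply/matrixP => i j.
by rewrite E // mul_mx_diag mul_diag_mx !mxE mulrAC.
Qed.
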